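(* All coefficients of the formal power series in $q$ \[(-q;q)_\infty \sum_{n\geq 0} \frac{(-1)^n q^{\frac{n(n+1)}{2}}}{(-q;q)_n}\] are nonnegative.
   Context: The $q$-Pochhammer symbol is $(a;q)_n=\prod_{i=0}^{n-1}(1-aq^i)$ for $n\in\mathbb{Z}_{\ge 0}\cup\{\infty\}$. *)

(* Defs.v *)
From HB Require Import structures.
From mathcomp Require Import all_boot all_order all_algebra.
From mathcomp Require Import boolp classical_sets.

Set Implicit Arguments.
Unset Strict Implicit.
Unset Printing Implicit Defensive.

Import Order.TTheory GRing.Theory Num.Theory.
Local Open Scope ring_scope.

Record fps (R : Type) := FPS { fps_coef : nat -> R }.

Declare Scope fps_scope.
Notation "{ 'fps' R }" := (fps R) (format "{ 'fps'  R }") : type_scope.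
Notation "f `[ k ]" := (fps_coef f k)
  (at level 2, left associativity, format "f `[ k ]") : fps_scope.
Local Open Scope fps_scope.

HB.instance Definition _ (R : Type) := [isNew for @fps_coef R].
HB.instance Definition _ (R : choiceType) := [Choice of {fps R} by <:].

Lemma fpsP (R : Type) (f g : {fps R}) :
  (forall k, f`[k] = g`[k]) <-> f = g.
Proof.
split=> [|-> //]; case: f g => [f] [g] /= fg.
by congr FPS; apply: funext.
Qed.

Section FpsRing.
Variable R : comUnitRingType.
Implicit Types (f g h : {fps R}) (k n : nat).

Definition fps_zero : {fps R} := FPS (fun=> 0).
Definition fps_opp f : {fps R} := FPS (fun k => - f`[k]).
Definition fps_add f g : {fps R} := FPS (fun k => f`[k] + g`[k]).
Definition fps_one : {fps R} := FPS (fun k => (k == 0%N)%:R).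
Definition fps_mul f g : {fps R} :=
  FPS (fun k => \sum_(i < k.+1) f`[i] * g`[k - i]).
Definition fpsX : {fps R} := FPS (fun k => (k == 1%N)%:R).

Fact fps_addA : associative fps_add.
Proof. by move=> f g h; apply/fpsP => k /=; rewrite addrA. Qed.
Fact fps_addC : commutative fps_add.
Proof. by move=> f g; apply/fpsP => k /=; rewrite addrC. Qed.
Fact fps_add0 : left_id fps_zero fps_add.
Proof. by move=> f; apply/fpsP => k /=; rewrite add0r. Qed.
Fact fps_addN : left_inverse fps_zero fps_opp fps_add.
Proof. by move=> f; apply/fpsP => k /=; rewrite addNr. Qed.

HB.instance Definition _ :=
  GRing.isZmodule.Build {fps R} fps_addA fps_addC fps_add0 fps_addN.

Definition fps_trunc n f : {poly R} := \poly_(i < n) f`[i].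

Lemma coef_fps_trunc n f k : (k < n)%N -> (fps_trunc n f)`_k = f`[k].
Proof. by move=> kn; rewrite coef_poly kn. Qed.

Lemma coef_fps_mul_trunc n f g k : (k < n)%N ->
  (fps_mul f g)`[k] = (fps_trunc n f * fps_trunc n g)`_k.
Proof.
move=> kn; rewrite coefM; apply: eq_bigr => i _.
have ik : (i <= k)%N by rewrite -ltnS.
by rewrite !coef_fps_trunc // (leq_ltn_trans _ kn) // leq_subr.
Qed.

Fact fps_mulC : commutative fps_mul.
Proof.
move=> f g; apply/fpsP => k.
by rewrite !(coef_fps_mul_trunc _ _ (ltnSn k)) mulrC.
Qed.

Fact fps_mulA : associative fps_mul.
Proof.
have mulA f g h k : (fps_mul f (fps_mul g h))`[k] =
    (fps_trunc k.+1 f * (fps_trunc k.+1 g * fps_trunc k.+1 h))`_k.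
  rewrite coefM; apply: eq_bigr => i _.
  rewrite coef_fps_trunc //; congr (_ * _).
  by rewrite (@coef_fps_mul_trunc k.+1) // ltnS leq_subr.
move=> f g h; apply/fpsP => k.
by rewrite [fps_mul _ h in RHS]fps_mulC !mulA mulrA mulrC.
Qed.

Fact fps_mul1 : left_id fps_one fps_mul.
Proof.
move=> f; apply/fpsP => k /=.
by rewrite big_ord_recl /= mul1r subn0 big1 ?addr0 // => i _; rewrite mul0r.
Qed.

Fact fps_mulDl : left_distributive fps_mul fps_add.
Proof.
move=> f g h; apply/fpsP => k /=; rewrite -big_split /=.
by apply: eq_bigr => i _; rewrite mulrDl.
Qed.

Fact fps_one_neq0 : fps_one != 0 :> {fps R}.
Proof.
apply/eqP => /fpsP /(_ 0%N) /= /eqP.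
by rewrite oner_eq0.
Qed.

HB.instance Definition _ := GRing.Zmodule_isComNzRing.Build {fps R}
  fps_mulA fps_mulC fps_mul1 fps_mulDl fps_one_neq0.

(* [fps_inv_seq f n] lists the coefficients of index < n of 1/f. *)
Fixpoint fps_inv_seq f n : seq R :=
  if n is m.+1 then
    let s := fps_inv_seq f m in
    rcons s (f`[0]^-1 * ((m == 0%N)%:R - \sum_(i < m) f`[m - i] * s`_i))
  else [::].

(* As for every [unitRingType], the inverse of a non-unit is itself. *)
Definition fps_unit : pred {fps R} := fun f => f`[0] \is a GRing.unit.
Definition fps_inv f : {fps R} :=
  if fps_unit f then FPS (fun k => (fps_inv_seq f k.+1)`_k) else f.

Lemma size_fps_inv_seq f n : size (fps_inv_seq f n) = n.
Proof. by elim: n => //= n IHn; rewrite size_rcons IHn. Qed.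

Lemma nth_fps_inv_seq f n k :
  (k < n)%N -> (fps_inv_seq f n)`_k = (fps_inv_seq f k.+1)`_k.
Proof.
elim: n => // n IHn; rewrite ltnS leq_eqVlt => /orP[/eqP-> //|kn].
by rewrite -IHn //= nth_rcons size_fps_inv_seq kn.
Qed.

Lemma coef_fps_inv f k : fps_unit f -> (fps_inv f)`[k] =
  f`[0]^-1 * ((k == 0%N)%:R - \sum_(i < k) f`[k - i] * (fps_inv f)`[i]).
Proof.
move=> uf; rewrite /fps_inv uf /fps_coef -/(fps_coef f) [LHS]/=.
rewrite nth_rcons size_fps_inv_seq ltnn eqxx.
congr (_ * (_ - _)); apply: eq_bigr => i _.
by congr (_ * _); rewrite nth_fps_inv_seq.
Qed.

Fact fps_mulV : {in fps_unit, left_inverse 1 fps_inv *%R}.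
Proof.
move=> f uf; have uf0 : f`[0] \is a GRing.unit := uf.
apply/fpsP => k; rewrite mulrC [_ * _]fps_mulC /= big_ord_recr /= subnn.
rewrite [(fps_inv f)`[k]]coef_fps_inv // mulrC mulrA divrr // mul1r.
rewrite addrC -addrA [X in _ + X]addrC.
by under [X in _ + (X - _)]eq_bigr do rewrite mulrC; rewrite subrr addr0.
Qed.

Fact fps_unitP f g : g * f = 1 -> fps_unit f.
Proof.
move=> /fpsP /(_ 0%N); rewrite /= big_ord1 subnn => gf1.
by apply/unitrPr; exists g`[0]; rewrite mulrC.
Qed.

Fact fps_inv_out : {in [predC fps_unit], fps_inv =1 id}.
Proof. by move=> f /negbTE nuf; rewrite /fps_inv [fps_unit f]nuf. Qed.

HB.instance Definition _ := GRing.ComNzRing_hasMulInverse.Build {fps R}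
  fps_mulV fps_unitP fps_inv_out.

Lemma coef_fps0 k : (0 : {fps R})`[k] = 0. Proof. by []. Qed.
Lemma coef_fpsN f k : (- f)`[k] = - f`[k]. Proof. by []. Qed.
Lemma coef_fpsD f g k : (f + g)`[k] = f`[k] + g`[k]. Proof. by []. Qed.
Lemma coef_fps1 k : (1 : {fps R})`[k] = (k == 0%N)%:R. Proof. by []. Qed.
Lemma coef_fpsM f g k :
  (f * g)`[k] = \sum_(i < k.+1) f`[i] * g`[k - i].
Proof. by []. Qed.
Lemma coef_fpsX k : fpsX`[k] = (k == 1%N)%:R. Proof. by []. Qed.
Lemma fps_unitE f : (f \is a GRing.unit) = (f`[0] \is a GRing.unit).
Proof. by []. Qed.

(* Formal convergence: each coefficient is eventually constant. *)
Definition fps_cvg_to (u : nat -> {fps R}) (l : {fps R}) : Prop :=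
  forall k, exists N, forall n, (N <= n)%N -> (u n)`[k] = l`[k].

(* Meaningful only for formally convergent sequences; see [fps_lim_eq]. *)
Definition fps_lim (u : nat -> {fps R}) : {fps R} :=
  xget 0 [set l | fps_cvg_to u l]%classic.

Definition fps_sum (u : nat -> {fps R}) : {fps R} :=
  fps_lim (fun n => \sum_(i < n) u i).

Definition qpoch (a q : {fps R}) n : {fps R} :=
  \prod_(i < n) (1 - a * q ^+ i).

Definition qpoch_inf (a q : {fps R}) : {fps R} := fps_lim (qpoch a q).

Lemma qpochS (a q : {fps R}) n :
  qpoch a q n.+1 = qpoch a q n * (1 - a * q ^+ n).
Proof. by rewrite /qpoch big_ord_recr. Qed.

Lemma fps_cvg_uniq u l l' : fps_cvg_to u l -> fps_cvg_to u l' -> l = l'.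
Proof.
move=> ul ul'; apply/fpsP => k.
have [N uN] := ul k; have [N' uN'] := ul' k.
by rewrite -(uN (maxn N N')) ?leq_maxl // uN' // leq_maxr.
Qed.

Lemma fps_lim_eq u l : fps_cvg_to u l -> fps_lim u = l.
Proof.
move=> ul; apply: fps_cvg_uniq (ul).
exact: (@xgetPex _ 0 [set l | fps_cvg_to u l]%classic (ex_intro _ l ul)).
Qed.

Lemma fps_cvg_stationary u :
  (forall n k, (k < n)%N -> (u n.+1)`[k] = (u n)`[k]) ->
  fps_cvg_to u (fps_lim u).
Proof.
move=> stat; suff ul : fps_cvg_to u (FPS (fun k => (u k.+1)`[k])).
  by rewrite (fps_lim_eq ul).
move=> k; exists k.+1 => n /subnK <-; elim: (n - k.+1)%N => //= m IHm.
by rewrite addSn stat // ltn_addl.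
Qed.

Lemma fps_sum_cvg u : (forall n k, (k < n)%N -> (u n)`[k] = 0) ->
  fps_cvg_to (fun n => \sum_(i < n) u i) (fps_sum u).
Proof.
move=> u0; apply: fps_cvg_stationary => n k kn.
by rewrite big_ord_recr /= u0 // addr0.
Qed.

Lemma coef_fpsM_lt f g m n k :
  (forall i, (i < m)%N -> f`[i] = 0) -> (forall i, (i < n)%N -> g`[i] = 0) ->
  (k < m + n)%N -> (f * g)`[k] = 0.
Proof.
move=> f0 g0 kmn; rewrite coef_fpsM big1 // => i _.
have [im|mi] := ltnP i m; first by rewrite f0 // mul0r.
have ik : (i <= k)%N by rewrite -ltnS.
by rewrite g0 ?mulr0 // ltn_subLR // (leq_trans kmn) // leq_add2r.
Qed.

Lemma coef_fps_exp_lt q n k : q`[0] = 0 -> (k < n)%N -> (q ^+ n)`[k] = 0.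
Proof.
move=> q0; elim: n k => // n IHn k kn.
by rewrite exprS; apply: (coef_fpsM_lt (m := 1) (n := n)) => // -[].
Qed.

Lemma qpoch_inf_cvg (a q : {fps R}) : q`[0] = 0 ->
  fps_cvg_to (qpoch a q) (qpoch_inf a q).
Proof.
move=> q0; apply: fps_cvg_stationary => n k kn.
rewrite qpochS mulrBr mulr1 coef_fpsD coef_fpsN.
rewrite mulrA (coef_fpsM_lt (m := 0) (n := n)) ?subr0 // => i.
exact: coef_fps_exp_lt.
Qed.

Lemma qpoch_unit (a q : {fps R}) n : a`[0] = 0 ->
  qpoch a q n \is a GRing.unit.
Proof.
move=> a0; apply: rpred_prod => i _.
rewrite fps_unitE coef_fpsD coef_fpsN coef_fps1.
by rewrite coef_fpsM big_ord1 a0 mul0r subr0 unitr1.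
Qed.

Lemma fps_sum_qpoch_cvg :
  let u n := (-1) ^+ n * fpsX ^+ (n * n.+1)./2 / qpoch (- fpsX) fpsX n in
  fps_cvg_to (fun n => \sum_(i < n) u i) (fps_sum u).
Proof.
apply: fps_sum_cvg => n k kn; rewrite mulrAC.
apply: (coef_fpsM_lt (m := 0) (n := n)) => // i i_n.
apply: coef_fps_exp_lt => //; apply: leq_trans i_n _.
case: n kn => // n _; rewrite -[leqLHS](doubleK n.+1) half_leq //.
by rewrite -muln2 leq_mul2l.
Qed.

End FpsRing.

Arguments fpsX {R}.

(* Main.v *)
Require Import Defs.
From mathcomp Require Import all_boot all_order all_algebra.
From mathcomp Require Import ring.
Import GRing.Theory Num.Theory.
Local Open Scope ring_scope.
Local Open Scope fps_scope.

(** Multiplying the n-th summand by (-q;q)_oo gives (-1)^n q^(1+...+n) times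
    the product of the (1 + q^i) for i > n, the signed generating function of
    the partitions into distinct parts that contain 1, ..., n.  The summands of
    index 2m and 2m+1 add up to q^(1+...+2m) times the product of the (1 + q^i)
    for i > 2m+1, which has nonnegative coefficients. *)

(** The maximum of finitely many thresholds serves all indices below [k] at once, as a coefficient
    of a Cauchy product requires. *)
Lemma fps_cvg_to_prefix {R : comUnitRingType} (u : nat -> {fps R})
    (l : {fps R}) (k : nat) :
  fps_cvg_to u l ->
  exists N, forall n i, (N <= n)%N -> (i < k)%N -> (u n)`[i] = l`[i].
Proof.
move=> ul; elim: k => [|k [N uN]]; first by exists 0%N.
have [N' uN'] := ul k; exists (maxn N N') => n i.
rewrite geq_max => /andP[Nn N'n].
by rewrite ltnS leq_eqVlt => /predU1P[->|ik]; [exact: uN' | exact: uN].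
Qed.

Lemma fps_cvg_toM {R : comUnitRingType} (u v : nat -> {fps R})
    (l m : {fps R}) :
  fps_cvg_to u l -> fps_cvg_to v m -> fps_cvg_to (fun n => u n * v n) (l * m).
Proof.
move=> ul vm k.
have [N uN] := fps_cvg_to_prefix _ _ k.+1 ul.
have [N' vN'] := fps_cvg_to_prefix _ _ k.+1 vm.
exists (maxn N N') => n; rewrite geq_max => /andP[Nn N'n].
rewrite !coef_fpsM; apply: eq_bigr => i _.
by rewrite uN // vN' // ltnS leq_subr.
Qed.

Definition fps_nneg {R : numDomainType} (f : {fps R}) : Prop :=
  forall k, 0 <= f`[k].

Section Nonnegative.
Variable R : numDomainType.
Implicit Types f g : {fps R}.

Lemma fps_nneg1 : fps_nneg (1 : {fps R}).
Proof. by move=> k; rewrite coef_fps1 ler0n. Qed.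

Lemma fps_nnegD f g : fps_nneg f -> fps_nneg g -> fps_nneg (f + g).
Proof. by move=> f0 g0 k; rewrite coef_fpsD addr_ge0. Qed.

Lemma fps_nnegM f g : fps_nneg f -> fps_nneg g -> fps_nneg (f * g).
Proof.
by move=> f0 g0 k; rewrite coef_fpsM sumr_ge0 // => i _; rewrite mulr_ge0.
Qed.

Lemma fps_nnegXn n : fps_nneg (fpsX ^+ n : {fps R}).
Proof.
elim: n => [|n IHn]; first by rewrite expr0; exact: fps_nneg1.
by rewrite exprS; apply: fps_nnegM => // k; rewrite coef_fpsX ler0n.
Qed.

End Nonnegative.

(** Consecutive triangular numbers differ by 2m+1 here, so the paired summands share the factor
    [q ^+ T]. *)
Lemma halfM_doubleS m :
  (m.*2.+1 * m.*2.+2)./2 = ((m.*2 * m.*2.+1)./2 + m.*2.+1)%N.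
Proof.
by rewrite -doubleS -doubleMl -doubleMr !doubleK mulnS addnC mulnC.
Qed.

(** Truncating the product at the same even index as the sum allows an induction that adds one pair
    of summands at a time. *)
Lemma qpoch_even_partial_sum_nneg (R : numDomainType) (m : nat) :
  let q : {fps R} := fpsX in
  fps_nneg (qpoch (- q) q m.*2 *
    \sum_(0 <= n < m.*2) (-1) ^+ n * q ^+ (n * n.+1)./2 / qpoch (- q) q n).
Proof.
move=> q.
have Punit n : qpoch (- q) q n \is a GRing.unit.
  by apply: qpoch_unit; rewrite coef_fpsN coef_fpsX oppr0.
have PS n : qpoch (- q) q n.+1 = qpoch (- q) q n * (1 + q ^+ n.+1).
  by rewrite qpochS mulNr opprK -exprS.
have nneg_factor n : fps_nneg (1 + q ^+ n).
  by apply: fps_nnegD; [exact: fps_nneg1 | exact: fps_nnegXn].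
elim: m => [|m IHm]; first by rewrite big_geq // mulr0.
rewrite doubleS !big_nat_recr // halfM_doubleS.
set S := \sum_(0 <= n < _) _ in IHm *.
set P := qpoch (- q) q m.*2 in IHm *.
set P' := qpoch (- q) q m.*2.+1.
set T := (_ * _)./2.
have PV : P * P^-1 = 1 by rewrite divrr ?Punit.
have PV' : P' * P'^-1 = 1 by rewrite divrr ?Punit.
(* The old part gains two factors; the new pair collapses because (1 + q^(2m+1)) - q^(2m+1) = 1. *)
have -> : qpoch (- q) q m.*2.+2 *
    (S + (-1) ^+ m.*2 * q ^+ T / P
       + (-1) ^+ m.*2.+1 * q ^+ (T + m.*2.+1) / P') =
    P * S * ((1 + q ^+ m.*2.+1) * (1 + q ^+ m.*2.+2))
    + q ^+ T * (1 + q ^+ m.*2.+2).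
  rewrite exprS -signr_odd odd_double expr0 mulr1 mul1r mulN1r exprD !mulrDr.
  (* Keeping [P * P^-1] grouped leaves a polynomial identity for [ring]; [PV] cancels it
     afterwards. *)
  have -> : qpoch (- q) q m.*2.+2 * (q ^+ T / P)
      = (P * P^-1) * (q ^+ T * ((1 + q ^+ m.*2.+1) * (1 + q ^+ m.*2.+2))).
    by rewrite !PS -/P; ring.
  have -> : qpoch (- q) q m.*2.+2 * (- (q ^+ T * q ^+ m.*2.+1) / P')
      = - ((P' * P'^-1) * (q ^+ T * q ^+ m.*2.+1 * (1 + q ^+ m.*2.+2))).
    by rewrite PS -/P'; ring.
  by rewrite PV PV' !PS -/P; ring.
apply: fps_nnegD; apply: fps_nnegM => //; first exact: fps_nnegM.
exact: fps_nnegXn.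
Qed.

Theorem theorem3p2 (k : nat) :
  let q : {fps int} := fpsX in
  0 <= (qpoch_inf (- q) q *
        fps_sum (fun n : nat =>
          (-1) ^+ n * q ^+ (n * n.+1)./2 / qpoch (- q) q n))`[k].
Proof.
cbv zeta; set q : {fps int} := fpsX.
have q0 : q`[0] = 0 by rewrite coef_fpsX.
have [N PS_N] :=
  fps_cvg_toM _ _ _ _ (qpoch_inf_cvg (- q) q0) (fps_sum_qpoch_cvg int) k.
(* The index [N.*2] is past the threshold [N] and even, so no summand is left unpaired. *)
rewrite -(PS_N N.*2); last by rewrite -addnn leq_addr.
have := qpoch_even_partial_sum_nneg int N k.
by rewrite big_mkord.
Qed.
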